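(* Let $\phi:M_3\to M_3$ be a linear preserver of the Lorentz spectrum. Then for all $A\in M_3$, $$\sigma_{int}(A)=\sigma_{int}(\phi(A)) \quad \text{and} \quad \sigma_{bd}(A)= \sigma_{bd}(\phi(A)).$$
   Context: $M_n$ denotes the vector space of $n\times n$ real matrices. The Lorentz cone in $\mathbb{R}^3$ is $\mathcal{K}_3=\{[\xi^T,\eta]^T : \xi\in\mathbb{R}^2,\ \eta\in\mathbb{R},\ \|\xi\|_2\le \eta\}$. For $A\in M_3$, a real number $\lambda$ is a Lorentz eigenvalue of $A$ if there is a nonzero $x\in\mathbb{R}^3$ (an associated Lorentz eigenvector) with $x\in\mathcal{K}_3$, $(A-\lambda I)x\in\mathcal{K}_3$ and $x^T(A-\lambda I)x=0$. The Lorentz spectrum $\sigma_L(A)$ is the set of all Lorentz eigenvalues of $A$. The interior Lorentz spectrum $\sigma_{int}(A)$ (resp. boundary Lorentz spectrum $\sigma_{bd}(A)$) is the set of all Lorentz eigenvalues of $A$ that have an associated Lorentz eigenvector in the interior (resp. on the boundary) of $\mathcal{K}_3$; these two sets need not be disjoint. A linear preserver of the Lorentz spectrum on $M_3$ is a linear map $\phi:M_3\to M_3$ such that $\sigma_L(\phi(A))=\sigma_L(A)$ for all $A\in M_3$. *)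

(* Defs.v *)
From HB Require Import structures.
From mathcomp Require Import all_boot all_order all_algebra.
From mathcomp Require Import all_classical all_reals all_analysis.

Set Implicit Arguments.
Unset Strict Implicit.
Unset Printing Implicit Defensive.

Import Order.TTheory GRing.Theory Num.Theory.
Import numFieldNormedType.Exports.

Local Open Scope classical_set_scope.
Local Open Scope ring_scope.

(* The library norm `|x| on 'cV[R]_n is the sup norm, so the Euclidean norm is
   defined here; both norms induce the topology used in [interior]. *)
Definition norm2 (R : realType) (n : nat) (x : 'cV[R]_n) : R :=
  Num.sqrt (\sum_(i < n) x i 0 ^+ 2).

Definition lorentz_cone (R : realType) : set 'cV[R]_3 :=
  [set x | exists (xi : 'cV[R]_2) (eta : R),
     x = col_mx xi eta%:M /\ norm2 xi <= eta].

Definition boundary (T : topologicalType) (S : set T) : set T :=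
  closure S `\` interior S.

Definition lorentz_eigenpair (R : realType) (A : 'M[R]_3) (lambda : R)
    (x : 'cV[R]_3) : Prop :=
  [/\ x != 0,
      lorentz_cone x,
      lorentz_cone ((A - lambda%:M) *m x) &
      x^T *m (A - lambda%:M) *m x = 0].

Definition lorentz_spectrum (R : realType) (A : 'M[R]_3) : set R :=
  [set lambda | exists x : 'cV[R]_3, lorentz_eigenpair A lambda x].

Definition lorentz_spectrum_int (R : realType) (A : 'M[R]_3) : set R :=
  [set lambda | exists x : 'cV[R]_3,
     lorentz_eigenpair A lambda x /\ interior (@lorentz_cone R) x].

Definition lorentz_spectrum_bd (R : realType) (A : 'M[R]_3) : set R :=
  [set lambda | exists x : 'cV[R]_3,
     lorentz_eigenpair A lambda x /\ boundary (@lorentz_cone R) x].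

Definition preserves_lorentz_spectrum (R : realType)
    (phi : 'M[R]_3 -> 'M[R]_3) : Prop :=
  forall A : 'M[R]_3, lorentz_spectrum (phi A) = lorentz_spectrum A.

(* Main.v *)
(* A preserver phi has the form A |-> P A P^T with P = Q (+) [1] and Q orthogonal, which gives
   the claim since P preserves the cone and its interior.
   - Infinite Lorentz spectra occur only for the matrices [[a I, 0], [w^T, d]]. Reading off
     their spectra shows that phi maps [[0, 0], [w^T, d]] to [[0, 0], [(Q w)^T, d]].
   - If A (om, 1) = (n om, rho) with |om| = 1, then n is in the spectrum of
     A + [[0, 0], [M om^T, - M + n - rho]] for every M; letting M tend to infinity in the
     spectrum of the image, for A and for - A, gives phi(A) (Q om, 1) = (n Q om, rho).
   - So phi(A) P - P A kills (om, 1) whenever A (om, 1) has no tangential component. Taking om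
     among the four points (1, 0), (-1, 0), (0, 1), (0, -1), matrices for which this happens at
     three of these points span all matrices, hence phi(A) P = P A. *)
Require Import Defs.
From HB Require Import structures.
From mathcomp Require Import all_boot all_order all_algebra.
From mathcomp Require Import all_classical all_reals all_analysis.
From mathcomp Require Import ring lra.

Set Implicit Arguments.
Unset Strict Implicit.
Unset Printing Implicit Defensive.

Import Order.TTheory GRing.Theory Num.Theory.
Import numFieldNormedType.Exports.

Local Open Scope classical_set_scope.
Local Open Scope ring_scope.

(** * Explicit coordinates for matrices and vectors of size 3 *)

Lemma ord3_ind (P : 'I_3 -> Prop) : P 0 -> P 1 -> P 2 -> forall i, P i.
Proof.
move=> P0 P1 P2 [[|[|[|//]]] lti].
- by have -> : Ordinal lti = 0 by exact: val_inj.
- by have -> : Ordinal lti = 1 by exact: val_inj.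
- by have -> : Ordinal lti = 2 by exact: val_inj.
Qed.

Lemma sum3E (V : nmodType) (F : 'I_3 -> V) : \sum_i F i = F 0 + F 1 + F 2.
Proof.
rewrite !big_ord_recl big_ord0 addr0 addrA.
by congr (F _ + F _ + F _); exact: val_inj.
Qed.

Definition mx3 (R : Type) (a b c d e f g h k : R) : 'M[R]_3 :=
  \matrix_(i, j) nth k (nth [::] [:: [:: a; b; c]; [:: d; e; f]; [:: g; h; k]] i) j.

Definition cv3 (R : Type) (x y z : R) : 'cV[R]_3 :=
  \col_i nth z [:: x; y; z] i.

Lemma mx3E (R : Type) (a b c d e f g h k : R) (A := mx3 a b c d e f g h k) :
  ((A 0 0 = a) * (A 0 1 = b) * (A 0 2 = c) * (A 1 0 = d) * (A 1 1 = e) *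
   (A 1 2 = f) * (A 2 0 = g) * (A 2 1 = h) * (A 2 2 = k))%type.
Proof. by rewrite /A /mx3 !mxE. Qed.

Lemma cv3E (R : Type) (x y z : R) (v := cv3 x y z) :
  ((v 0 0 = x) * (v 1 0 = y) * (v 2 0 = z))%type.
Proof. by rewrite /v /cv3 !mxE. Qed.

Lemma mx3P (R : Type) (A B : 'M[R]_3) :
  A 0 0 = B 0 0 -> A 0 1 = B 0 1 -> A 0 2 = B 0 2 ->
  A 1 0 = B 1 0 -> A 1 1 = B 1 1 -> A 1 2 = B 1 2 ->
  A 2 0 = B 2 0 -> A 2 1 = B 2 1 -> A 2 2 = B 2 2 -> A = B.
Proof. by move=> *; apply/matrixP => i j; elim/ord3_ind: i; elim/ord3_ind: j. Qed.

Lemma cv3P (R : Type) (x y : 'cV[R]_3) :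
  x 0 0 = y 0 0 -> x 1 0 = y 1 0 -> x 2 0 = y 2 0 -> x = y.
Proof. by move=> *; apply/colP => i; elim/ord3_ind: i. Qed.

Lemma mx3D (R : nmodType) (a b c d e f g h k a' b' c' d' e' f' g' h' k' : R) :
  mx3 a b c d e f g h k + mx3 a' b' c' d' e' f' g' h' k' =
  mx3 (a + a') (b + b') (c + c') (d + d') (e + e') (f + f') (g + g') (h + h') (k + k').
Proof. by apply: mx3P; rewrite mxE !mx3E. Qed.

Lemma cv3D (R : nmodType) (a b c a' b' c' : R) :
  cv3 a b c + cv3 a' b' c' = cv3 (a + a') (b + b') (c + c').
Proof. by apply: cv3P; rewrite mxE !cv3E. Qed.

Lemma cv3_inj (R : Type) (a b c a' b' c' : R) :
  cv3 a b c = cv3 a' b' c' -> [/\ a = a', b = b' & c = c'].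
Proof.
by move=> E; split; [have := congr1 (fun x : 'cV_3 => x 0 0) E
  | have := congr1 (fun x : 'cV_3 => x 1 0) E
  | have := congr1 (fun x : 'cV_3 => x 2 0) E]; rewrite !cv3E.
Qed.

(** * The cone and the Lorentz spectrum in coordinates *)

Lemma lorentz_coneP (R : realType) (x : 'cV[R]_3) :
  lorentz_cone x <-> 0 <= x 2 0 /\ x 0 0 ^+ 2 + x 1 0 ^+ 2 <= x 2 0 ^+ 2.
Proof.
have E0 : (0 : 'I_3) = lshift 1 (0 : 'I_2) by exact: val_inj.
have E1 : (1 : 'I_3) = lshift 1 (1 : 'I_2) by exact: val_inj.
have E2 : (2 : 'I_3) = rshift 2 (0 : 'I_1) by exact: val_inj.
have E20 : ord0 = 0 :> 'I_2 by exact: val_inj.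
have E21 : lift ord0 ord0 = 1 :> 'I_2 by exact: val_inj.
split=> [[xi [eta [-> h]]]|[h0 h]].
  have eta0 : 0 <= eta by apply: le_trans h; exact: sqrtr_ge0.
  rewrite E2 E0 E1 !(col_mxEu xi) (col_mxEd xi) mxE eqxx mulr1n; split => //.
  move: h; rewrite /norm2 !big_ord_recl big_ord0 addr0 E20 E21 => h.
  rewrite -ler_sqrt ?sqr_ge0 // sqrtr_sqr (ger0_norm eta0) //.
exists (usubmx (x : 'M[R]_(2 + 1, 1))), (x 2 0); split.
  rewrite -[x in LHS](vsubmxK (x : 'M[R]_(2 + 1, 1))); congr col_mx.
  by rewrite [LHS]mx11_scalar mxE E2.
rewrite /norm2 !big_ord_recl big_ord0 addr0 E20 E21 !mxE -E0 -E1.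
by rewrite -[in leRHS](ger0_norm h0) -sqrtr_sqr; exact: ler_wsqrtr.
Qed.

Lemma mulmx3E (R : pzSemiRingType) (n : nat) (A : 'M[R]_3) (B : 'M[R]_(3, n)) i j :
  (A *m B) i j = A i 0 * B 0 j + A i 1 * B 1 j + A i 2 * B 2 j.
Proof. by rewrite mxE sum3E. Qed.

Lemma mulmx_cv3 (R : pzSemiRingType) (B : 'M[R]_3) a b c :
  B *m cv3 a b c = cv3 (B 0 0 * a + B 0 1 * b + B 0 2 * c)
    (B 1 0 * a + B 1 1 * b + B 1 2 * c) (B 2 0 * a + B 2 1 * b + B 2 2 * c).
Proof. by apply: cv3P; rewrite mulmx3E !cv3E. Qed.

(** Two orthogonal vectors [(a, b, 1)] and [(p, q, t)] of the cone: the sum of the squares of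
    [p + t a] and [q + t b] is at most [- t^2 (1 - a^2 - b^2)], which is nonpositive, so everything
    vanishes. *)
Lemma cone_complementary (R : realFieldType) (a b p q t : R) :
  0 <= t -> a ^+ 2 + b ^+ 2 <= 1 -> p ^+ 2 + q ^+ 2 <= t ^+ 2 ->
  a * p + b * q + t = 0 ->
  [/\ t * (1 - a ^+ 2 - b ^+ 2) = 0, p = - t * a & q = - t * b].
Proof.
move=> t0 ab pq E.
have Et : t = - (a * p + b * q) by lra.
have s0 : 0 <= 1 - a ^+ 2 - b ^+ 2 by lra.
have sq : (p + t * a) ^+ 2 + (q + t * b) ^+ 2 <= - (t ^+ 2 * (1 - a ^+ 2 - b ^+ 2)).
  have -> : (p + t * a) ^+ 2 + (q + t * b) ^+ 2 =
    p ^+ 2 + q ^+ 2 + t * (2 * (a * p + b * q + t)) - t ^+ 2 - t ^+ 2 * (1 - a ^+ 2 - b ^+ 2) by ring.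
  rewrite E; lra.
have ts0 : 0 <= t ^+ 2 * (1 - a ^+ 2 - b ^+ 2) by rewrite mulr_ge0 ?sqr_ge0.
have pa : (p + t * a) ^+ 2 = 0.
  by apply/eqP; rewrite eq_le sqr_ge0 andbT; have := sqr_ge0 (q + t * b); lra.
have qb : (q + t * b) ^+ 2 = 0.
  by apply/eqP; rewrite eq_le sqr_ge0 andbT; have := sqr_ge0 (p + t * a); lra.
move/eqP: pa; rewrite sqrf_eq0 => /eqP pa; move/eqP: qb; rewrite sqrf_eq0 => /eqP qb.
split; [|lra|lra].
have : t ^+ 2 * (1 - a ^+ 2 - b ^+ 2) = 0.
  by have := sqr_ge0 (p + t * a); have := sqr_ge0 (q + t * b); lra.
move/eqP; rewrite mulf_eq0 sqrf_eq0 => /orP[] /eqP ->; by rewrite ?mul0r ?mulr0.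
Qed.

(** This allows eigenvectors to be scaled to height 1. *)
Lemma lorentz_cone_gt0 (R : realType) (x : 'cV[R]_3) :
  x != 0 -> lorentz_cone x -> 0 < x 2 0.
Proof.
move=> x0 /lorentz_coneP [h2 hx].
rewrite lt_neqAle h2 andbT eq_sym; apply/negP => /eqP x2.
move/eqP: x0; apply; apply: cv3P; rewrite mxE //; nra.
Qed.

(* The vector [x] is scaled to [(a, b, 1)]; self-duality of the cone then forces
   [(B - lam) x = t (- a, - b, 1)]. *)
Lemma lorentz_spectrumP (R : realType) (B : 'M[R]_3) (lam : R) :
  lorentz_spectrum B lam <-> exists a b t : R,
    [/\ 0 <= t, a ^+ 2 + b ^+ 2 <= 1, t * (1 - a ^+ 2 - b ^+ 2) = 0 &
        B *m cv3 a b 1 = cv3 ((lam - t) * a) ((lam - t) * b) (lam + t)].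
Proof.
split.
  move=> [x [x0 /lorentz_coneP [h2 hx] /lorentz_coneP [g2 gx]]].
  move=> /matrixP/(_ 0 0).
  rewrite -mulmxA mxE sum3E.
  move: gx g2; set w := (_ *m x) => gx g2 hw.
  have x2 := lorentz_cone_gt0 x0 (iffRL (lorentz_coneP x) (conj h2 hx)).
  have wE i : (B *m x) i 0 = w i 0 + lam * x i 0.
    by rewrite /w mulmxBl mul_scalar_mx !mxE; lra.
  rewrite ![x^T _ _]mxE [RHS]mxE in hw.
  exists (x 0 0 / x 2 0), (x 1 0 / x 2 0), (w 2 0 / x 2 0).
  have [tab pE qE] : [/\ (w 2 0 / x 2 0) * (1 - (x 0 0 / x 2 0) ^+ 2 - (x 1 0 / x 2 0) ^+ 2) = 0,
      w 0 0 / x 2 0 = - (w 2 0 / x 2 0) * (x 0 0 / x 2 0) &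
      w 1 0 / x 2 0 = - (w 2 0 / x 2 0) * (x 1 0 / x 2 0)].
    apply: cone_complementary.
    - by rewrite divr_ge0.
    - by rewrite !expr_div_n -mulrDl ler_pdivrMr ?mul1r ?exprn_gt0.
    - by rewrite !expr_div_n -mulrDl ler_pM2r ?invr_gt0 ?exprn_gt0.
    - transitivity ((x 0 0 * w 0 0 + x 1 0 * w 1 0 + x 2 0 * w 2 0) / x 2 0 ^+ 2).
        by field; rewrite gt_eqF.
      by rewrite hw mul0r.
  split => //.
  - by rewrite divr_ge0.
  - by rewrite !expr_div_n -mulrDl ler_pdivrMr ?mul1r ?exprn_gt0.
  have -> : B *m cv3 (x 0 0 / x 2 0) (x 1 0 / x 2 0) 1 = (x 2 0)^-1 *: (B *m x).
    rewrite scalemxAr; congr (_ *m _); apply: cv3P; rewrite [RHS]mxE cv3E.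
    - by rewrite mulrC.
    - by rewrite mulrC.
    - by rewrite mulVf ?gt_eqF.
  apply: cv3P; rewrite mxE wE cv3E mulrDr mulrC.
  - by rewrite pE; ring.
  - by rewrite qE; ring.
  - by rewrite mulrCA mulVf ?gt_eqF // mulr1 addrC.
move=> [a [b [t [t0 ab1 tab E]]]].
exists (cv3 a b 1); split.
- apply/eqP => /colP/(_ 2); rewrite !mxE => /eqP; by rewrite oner_eq0.
- by apply/lorentz_coneP; rewrite !cv3E expr1n.
- rewrite mulmxBl E mul_scalar_mx; apply/lorentz_coneP; rewrite !mxE /=.
  split; first lra.
  have : t * (t * (1 - a ^+ 2 - b ^+ 2)) = 0 by rewrite tab mulr0.
  lra.
apply/matrixP => i j; rewrite !ord1 -mulmxA mxE sum3E mulmxBl E mul_scalar_mx !mxE /=.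
lra.
Qed.

(** * Lorentz spectra of arrow matrices *)

Definition arrow_mx (R : pzRingType) (a u v d : R) : 'M[R]_3 :=
  mx3 a 0 0 0 a 0 u v d.

Lemma ex_unit_dot (R : rcfType) (u v m : R) : m ^+ 2 <= u ^+ 2 + v ^+ 2 ->
  exists a b : R, a ^+ 2 + b ^+ 2 = 1 /\ u * a + v * b = m.
Proof.
move=> mN; set N := u ^+ 2 + v ^+ 2.
have [N0|N0] := eqVneq N 0.
  have m0 : m = 0.
    by apply/eqP; rewrite -sqrf_eq0 eq_le sqr_ge0 andbT -N0.
  have u0 : u = 0.
    by apply/eqP; rewrite -sqrf_eq0 eq_le sqr_ge0 andbT -N0 lerDl sqr_ge0.
  have v0 : v = 0.
    by apply/eqP; rewrite -sqrf_eq0 eq_le sqr_ge0 andbT -N0 lerDr sqr_ge0.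
  by exists 1, 0; rewrite u0 v0 m0; split; ring.
set k := Num.sqrt (N - m ^+ 2).
have kE : k ^+ 2 = N - m ^+ 2 by rewrite sqr_sqrtr // subr_ge0.
(* With [w = (u, v)], this is [m / N] times [w] plus [k / N] times [w] turned by a right angle; [k]
   is chosen to make the length 1. *)
exists ((m * u - k * v) / N), ((m * v + k * u) / N); split; last first.
  by rewrite /N; field.
transitivity ((m ^+ 2 + k ^+ 2) / N); last by rewrite kE; field.
by rewrite /N; field.
Qed.

Lemma cauchy2 (R : realDomainType) (u v a b : R) : a ^+ 2 + b ^+ 2 <= 1 ->
  (u * a + v * b) ^+ 2 <= u ^+ 2 + v ^+ 2.
Proof.
move=> ab; have h : 0 <= (u ^+ 2 + v ^+ 2) * (1 - a ^+ 2 - b ^+ 2).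
  by apply: mulr_ge0; [rewrite addr_ge0 ?sqr_ge0 | lra].
by have := sqr_ge0 (u * b - v * a); lra.
Qed.

(** The first two rows say that [a] and [lam - t] agree on [(x, y)]. Either [x = y = 0], which
    forces [t = 0] and [lam = d], or [t = lam - a], and the last row becomes
    [u x + v y = 2 lam - a - d]. *)
Lemma lorentz_spectrum_arrow (R : realType) (a u v d lam : R) :
  lorentz_spectrum (arrow_mx a u v d) lam <->
  lam = d \/ (a <= lam /\ (2 * lam - a - d) ^+ 2 <= u ^+ 2 + v ^+ 2).
Proof.
rewrite lorentz_spectrumP; split.
  move=> [x [y [t [t0 xy txy]]]]; rewrite mulmx_cv3 !mx3E => E.
  have [E0 E1 E2] := cv3_inj E => {E}.
  have [x0|x0] := eqVneq x 0; last first.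
    have ta : a = lam - t by apply: (mulIf x0) => /=; lra.
    right; split; first lra.
    have -> : 2 * lam - a - d = u * x + v * y by lra.
    exact: cauchy2.
  have [y0|y0] := eqVneq y 0; last first.
    have ta : a = lam - t by apply: (mulIf y0) => /=; lra.
    right; split; first lra.
    have -> : 2 * lam - a - d = u * x + v * y by lra.
    exact: cauchy2.
  by left; rewrite x0 y0 in E2 txy; lra.
case=> [->|[alam /ex_unit_dot [x [y [xy xym]]]]].
  exists 0, 0, 0; split; rewrite ?mul0r //; first by lra.
  by rewrite mulmx_cv3 !mx3E; congr cv3; ring.
exists x, y, (lam - a); split; first lra.
- by rewrite xy.
- by rewrite -addrA -opprD xy subrr mulr0.
- by rewrite mulmx_cv3 !mx3E; congr cv3; lra.
Qed.

(** * Finiteness of the spectrum outside the arrow matrices *)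

Lemma finite_poly_roots (R : idomainType) (p : {poly R}) : p != 0 ->
  exists s : seq R, forall x, root p x -> x \in s.
Proof.
have [n] := ubnP (size p); elim: n p => // n IHn p.
rewrite ltnS => sp p0.
have [[x px]|nx] := pselect (exists x, root p x); last first.
  by exists [::] => x px; case: nx; exists x.
have /factor_theorem [q pE] := px.
have q0 : q != 0 by apply: contraNneq p0 => q0; rewrite pE q0 mul0r.
have [|//|s sP] := IHn q.
  by move: sp; rewrite pE size_Mmonic ?monicXsubC // size_XsubC addn2.
exists (x :: s) => y; rewrite pE rootM root_XsubC inE orbC.
by case/orP => [->//|/sP ->]; rewrite orbT.
Qed.

(* The boundary eigenvectors [(x, y, 1)] solve
   [al x y - be y^2 + ga x^2 - de y + ep x = 0] on the unit circle; eliminating [y] leaves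
   the quartic with coefficients [l] in [x]. *)
Lemma arrow_mx_or_finite_spectrum (R : realType) (B : 'M[R]_3) :
  (exists a u v d, B = arrow_mx a u v d) \/ exists s : seq R, forall lam, lorentz_spectrum B lam -> lam \in s.
Proof.
set al := B 1 1 - B 0 0; set be := B 0 1; set ga := B 1 0.
set de := B 0 2; set ep := B 1 2.
pose l := [:: be ^+ 2 - de ^+ 2; 2 * (al * de - be * ep);
  ep ^+ 2 - 2 * be * (ga + be) + de ^+ 2 - al ^+ 2;
  2 * (ep * (ga + be) - al * de); (ga + be) ^+ 2 + al ^+ 2].
have [G0|G0] := eqVneq (Poly l) 0.
  (* When the quartic vanishes identically, its leading coefficient is a sum of squares, so [al] and
     [ga + be] vanish; the quadratic coefficient then reduces to [ep^2 + de^2], and the constant one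
     to [be^2]. *)
  have lE i : l`_i = 0 by rewrite -coef_Poly G0 coef0.
  have := (lE 0%N, lE 2%N, lE 4%N); rewrite /= => -[[l0 l2] l4].
  have al0 : al = 0.
    by apply/eqP; rewrite -sqrf_eq0 eq_le sqr_ge0 andbT -l4 lerDr sqr_ge0.
  have gabe : ga + be = 0.
    by apply/eqP; rewrite -sqrf_eq0 eq_le sqr_ge0 andbT -l4 lerDl sqr_ge0.
  rewrite gabe al0 in l2.
  have de0 : de = 0.
    by apply/eqP; rewrite -sqrf_eq0 eq_le sqr_ge0 andbT; have := sqr_ge0 ep; lra.
  have ep0 : ep = 0.
    by apply/eqP; rewrite -sqrf_eq0 eq_le sqr_ge0 andbT; have := sqr_ge0 de; lra.
  have be0 : be = 0.
    by apply/eqP; rewrite -sqrf_eq0; rewrite de0 in l0; apply/eqP; lra.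
  left; exists (B 0 0), (B 2 0), (B 2 1), (B 2 2).
  by apply: mx3P; rewrite mx3E // -/be -/de -/ep -/ga; move: al0 gabe; rewrite /al; lra.
have [s1 s1P] := finite_poly_roots G0.
(* The case [t = 0] yields ordinary eigenvalues; the transpose appears because [eigenvalue] refers
   to row vectors. *)
have [s2 s2P] := finite_poly_roots (monic_neq0 (char_poly_monic B^T)).
(* On the unit circle the pairing of [(x, y, 1)] with its image is [(lam - t) + (lam + t)], so [lam]
   is a function of [(x, y)]. *)
pose f x y := (x * (B 0 0 * x + B 0 1 * y + B 0 2) +
  y * (B 1 0 * x + B 1 1 * y + B 1 2) + (B 2 0 * x + B 2 1 * y + B 2 2)) / 2.
right; exists ([seq f x (Num.sqrt (1 - x ^+ 2)) | x <- s1] ++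
  [seq f x (- Num.sqrt (1 - x ^+ 2)) | x <- s1] ++ s2) => lam.
move=> /lorentz_spectrumP [x [y [t [t0 xy txy E]]]].
rewrite !mem_cat.
have [t00|tn0] := eqVneq t 0.
  suff -> : lam \in s2 by rewrite !orbT.
  apply: s2P; rewrite -eigenvalue_root_char; apply/eigenvalueP.
  exists (cv3 x y 1)^T.
    by rewrite -trmx_mul E t00 subr0 addr0; apply/rowP => i; elim/ord3_ind: i; rewrite !mxE ?mulr1.
  by apply/eqP => /rowP/(_ 2); rewrite !mxE => /eqP; rewrite oner_eq0.
move/eqP: txy; rewrite mulf_eq0 (negbTE tn0) /= => /eqP xy1.
move: E; rewrite mulmx_cv3 !mulr1 => E; have [E0 E1 E2] := cv3_inj E.
have y2 : y ^+ 2 = 1 - x ^+ 2 by lra.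
have lamE : lam = f x y.
  rewrite /f E0 E1 E2.
  have -> : x * ((lam - t) * x) + y * ((lam - t) * y) = (lam - t) * (x ^+ 2 + y ^+ 2) by ring.
  rewrite y2; lra.
have xs1 : x \in s1.
  apply: s1P; rewrite /root horner_Poly /=; apply/eqP.
  have pE : - be + ep * x + (ga + be) * x ^+ 2 = - y * (al * x - de).
    have : y * (B 0 0 * x + B 0 1 * y + B 0 2) = x * (B 1 0 * x + B 1 1 * y + B 1 2).
      by rewrite E0 E1; ring.
    rewrite -/al -/be -/ga -/de -/ep => h.
    have -> : - be + ep * x + (ga + be) * x ^+ 2 = - be * y ^+ 2 + ep * x + ga * x ^+ 2.
      by rewrite y2; ring.
    by rewrite /al; lra.
  have : (- be + ep * x + (ga + be) * x ^+ 2) ^+ 2 = (1 - x ^+ 2) * (al * x - de) ^+ 2.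
    by rewrite pE -y2; ring.
  lra.
have [y0|y0] := leP 0 y.
  suff -> : lam \in [seq f x (Num.sqrt (1 - x ^+ 2)) | x <- s1] by [].
  by apply/mapP; exists x => //; rewrite -y2 sqrtr_sqr ger0_norm.
suff -> : lam \in [seq f x (- Num.sqrt (1 - x ^+ 2)) | x <- s1] by rewrite orbT.
by apply/mapP; exists x => //; rewrite -y2 sqrtr_sqr ltr0_norm // opprK.
Qed.

(** The numbers [L / (k + 1)] are pairwise distinct points of the segment, too many of them for any
    finite list. *)
Lemma segment_spectrum_arrow (R : realType) (B : 'M[R]_3) (L : R) : 0 < L ->
  (forall lam, 0 <= lam <= L -> lorentz_spectrum B lam) ->
  exists a u v d, B = arrow_mx a u v d.
Proof.
move=> L0 BL; have [//|[s sP]] := arrow_mx_or_finite_spectrum B.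
pose g (k : nat) := L / k.+1%:R.
have : (size (map g (iota 0 (size s).+1)) <= size s)%N.
  apply: uniq_leq_size => [|_ /mapP [k _ ->]].
    rewrite map_inj_uniq ?iota_uniq // => i j /(mulfI (lt0r_neq0 L0)) /invr_inj /eqP.
    by rewrite eqr_nat => /eqP [].
  apply/sP/BL; rewrite /g divr_ge0 ?(ltW L0) //= ler_pdivrMr ?ltr0n // ler_peMr ?(ltW L0) //.
  by rewrite ler1n.
by rewrite size_map size_iota ltnn.
Qed.

(** * Images of single arrow matrices under a preserver *)

Lemma arrow_mxD (R : pzRingType) (a u v d a' u' v' d' : R) :
  arrow_mx a u v d + arrow_mx a' u' v' d' =
  arrow_mx (a + a') (u + u') (v + v') (d + d').
Proof. by apply: mx3P; rewrite mxE !mx3E ?addr0. Qed.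

Lemma arrow_mxZ (R : pzRingType) (c a u v d : R) :
  c *: arrow_mx a u v d = arrow_mx (c * a) (c * u) (c * v) (c * d).
Proof. by apply: mx3P; rewrite mxE !mx3E ?mulr0. Qed.

Lemma arrow_mxN (R : pzRingType) (a u v d : R) :
  - arrow_mx a u v d = arrow_mx (- a) (- u) (- v) (- d).
Proof. by apply: mx3P; rewrite mxE !mx3E ?oppr0. Qed.

Lemma arrow_mx_inj (R : pzRingType) (a u v d a' u' v' d' : R) :
  arrow_mx a u v d = arrow_mx a' u' v' d' -> [/\ a = a', u = u', v = v' & d = d'].
Proof.
by move=> E; split; [have := congr1 (fun A : 'M[R]_3 => A 0 0) E
  | have := congr1 (fun A : 'M[R]_3 => A 2 0) E
  | have := congr1 (fun A : 'M[R]_3 => A 2 1) E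
  | have := congr1 (fun A : 'M[R]_3 => A 2 2) E]; rewrite !mx3E.
Qed.

Lemma sqr_le_sqrt (R : rcfType) (x N : R) : 0 <= N ->
  (x ^+ 2 <= N) = (- Num.sqrt N <= x <= Num.sqrt N).
Proof.
by move=> N0; rewrite -ler_norml -sqrtr_sqr ler_sqrt.
Qed.

(* The spectrum of [arrow_mx a u v d] is the point [d] together with the part above [a]
   of an interval of length [n = |(u, v)|] centred at [(a + d) / 2]. *)
Lemma arrow_spectrum_half (R : realFieldType) (d n a' d' n' : R) :
  0 <= n' -> - n < d < n ->
  (forall lam, lam = d' \/ (a' <= lam /\ - n' <= 2 * lam - a' - d' <= n') <->
     lam = d \/ (0 <= lam /\ - n <= 2 * lam - 0 - d <= n)) ->
  a' <= 0 /\ d + n <= a' + d' + n'.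
Proof.
move=> n0 dn H.
(* The isolated value [d'] may lie anywhere, so only spectral points different from it give
   information on the interval of the primed matrix. *)
have {}H lam : 0 <= lam <= (d + n) / 2 -> lam != d' ->
    a' <= lam /\ 2 * lam <= a' + d' + n'.
  move=> ln /eqP ld; have [|//|[al ?]] := iffRL (H lam).
    by right; lra.
  by split; lra.
(* Points of the segment avoiding [d'] still come arbitrarily close to its upper end. *)
have step c : c < (d + n) / 2 -> exists2 lam, 0 <= lam <= (d + n) / 2 & c < lam /\ lam != d'.
  move=> cT.
  have [d'T|d'T] := eqVneq d' ((d + n) / 2); last first.
    by exists ((d + n) / 2); [lra | rewrite eq_sym].
  have [c0|c0] := leP c 0.
    by exists ((d + n) / 4); [lra | split; [lra | apply/eqP; lra]].
  by exists ((c + (d + n) / 2) / 2); [lra | split; [lra | apply/eqP; lra]].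
split; rewrite leNgt; apply/negP => lt0.
  have [d'0|d'0] := eqVneq d' 0; last first.
    by have [| |? ?] := H 0; [lra | rewrite eq_sym | lra].
  have [aT|aT] := leP a' ((d + n) / 2).
    by have [| |? ?] := H (a' / 2); [lra | apply/eqP; lra | lra].
  by have [| |? ?] := H ((d + n) / 2); [lra | apply/eqP; lra | lra].
have [|lam lamT [clam lamd]] := step ((a' + d' + n') / 2); first by lra.
by have [//|//|? ?] := H lam; lra.
Qed.

(** The bound on [d] puts a nontrivial segment starting at 0 into the spectra of both the matrix and
    its negative, so the image is again an arrow matrix. Applying [arrow_spectrum_half] to both
    signs gives [a' = 0] and one inequality for each upper end. *)
Lemma preserver_arrow (R : realType) (phi : {linear 'M[R]_3 -> 'M[R]_3}) (u v d : R) :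
  preserves_lorentz_spectrum phi -> d ^+ 2 < u ^+ 2 + v ^+ 2 ->
  exists u' v', phi (arrow_mx 0 u v d) = arrow_mx 0 u' v' d /\
    u' ^+ 2 + v' ^+ 2 = u ^+ 2 + v ^+ 2.
Proof.
move=> hphi dN.
have N0 : 0 <= u ^+ 2 + v ^+ 2 by rewrite addr_ge0 ?sqr_ge0.
set n := Num.sqrt (u ^+ 2 + v ^+ 2).
have n0 : 0 <= n by exact: sqrtr_ge0.
have nE : n ^+ 2 = u ^+ 2 + v ^+ 2 by rewrite sqr_sqrtr.
have dn : - n < d < n.
  by rewrite -ltr_norml -sqrtr_sqr ltr_sqrt // (le_lt_trans _ dN) ?sqr_ge0.
have segP (a x y e lam : R) : lorentz_spectrum (arrow_mx a x y e) lam <->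
    lam = e \/ (a <= lam /\ - Num.sqrt (x ^+ 2 + y ^+ 2) <= 2 * lam - a - e <= Num.sqrt (x ^+ 2 + y ^+ 2)).
  by rewrite lorentz_spectrum_arrow sqr_le_sqrt // addr_ge0 ?sqr_ge0.
have [|lam /andP[l0 lL]|a' [u' [v' [d' E]]]] :=
    @segment_spectrum_arrow _ (phi (arrow_mx 0 u v d)) ((d + n) / 2).
- lra.
- by rewrite hphi; apply/segP; right; rewrite -/n; split; lra.
have n'0 : 0 <= Num.sqrt (u' ^+ 2 + v' ^+ 2) by exact: sqrtr_ge0.
have H lam := segP 0 u v d lam; move: H; rewrite -hphi E => H.
have {}H lam := iff_trans (iff_sym (segP a' u' v' d' lam)) (H lam).
have E' : phi (arrow_mx 0 (- u) (- v) (- d)) = arrow_mx (- a') (- u') (- v') (- d').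
  by rewrite -arrow_mxN -E -linearN arrow_mxN oppr0.
have H' lam := segP 0 (- u) (- v) (- d) lam; move: H'; rewrite -hphi E' => H'.
have {}H' lam := iff_trans (iff_sym (segP (- a') (- u') (- v') (- d') lam)) (H' lam).
move: H H' n'0 E; rewrite !sqrrN -/n; set n' := Num.sqrt _ => H H' n'0 E.
have n'E : n' ^+ 2 = u' ^+ 2 + v' ^+ 2 by rewrite sqr_sqrtr ?addr_ge0 ?sqr_ge0.
have [a0 dn'] := arrow_spectrum_half n'0 dn H.
have [|a0' dn''] := arrow_spectrum_half n'0 _ H'; first by lra.
have a'0 : a' = 0 by lra.
(* The upper ends of the image spectra are read back in the original spectra. This reverses both
   inequalities, so [d' + n' = d + n] and [n' - d' = n - d]. *)
have [|dT|[_ T1]] := iffLR (H ((d' + n') / 2)); [by right; lra | by lra | ].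
have [|dT|[_ T2]] := iffLR (H' ((n' - d') / 2)); [by right; lra | by lra | ].
have d'E : d' = d by lra.
have n'n : n' = n by lra.
by exists u', v'; rewrite a'0 d'E -nE -n'E n'n.
Qed.

(** * The isometry induced on arrow matrices, and transfer of radial boundary vectors *)

(** An elementary form of continuity: nonnegativity of a quadratic polynomial passes to a limit of
    points of the unit disc. *)
Lemma quad_closed (R : realFieldType) (k0 k1 k2 k3 k4 k5 p q : R) :
  p ^+ 2 + q ^+ 2 <= 1 ->
  (forall e, 0 < e -> exists x y, [/\ x ^+ 2 + y ^+ 2 <= 1, `|x - p| <= e, `|y - q| <= e &
     0 <= k0 + k1 * x + k2 * y + k3 * x ^+ 2 + k4 * (x * y) + k5 * y ^+ 2]) ->
  0 <= k0 + k1 * p + k2 * q + k3 * p ^+ 2 + k4 * (p * q) + k5 * q ^+ 2.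
Proof.
set F := fun x y => k0 + k1 * x + k2 * y + k3 * x ^+ 2 + k4 * (x * y) + k5 * y ^+ 2.
rewrite -/(F p q) => pq H; rewrite leNgt; apply/negP => Fneg.
have unit (x y : R) : x ^+ 2 + y ^+ 2 <= 1 -> `|x| <= 1 /\ `|y| <= 1.
  have := sqr_ge0 x; have := sqr_ge0 y; rewrite !ler_norml => *; split; apply/andP; split; nra.
have [p1 q1] := unit p q pq.
have bound (k h g e c : R) : `|h| <= e -> `|g| <= c -> k * (h * g) <= `|k| * (e * c).
  move=> he gc; rewrite (le_trans (ler_norm _)) //.
  by rewrite !normrM ler_wpM2l // ler_pM.
(* A Lipschitz constant of [F] on the disc, from [x^2 - p^2 = (x - p)(x + p)] and
   [x y - p q = (x - p) y + (y - q) p]. The choice of [e] then makes [F x y] at most [- e]. *)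
set C := `|k1| + `|k2| + 2 * `|k3| + 2 * `|k4| + 2 * `|k5|.
have C0 : 0 <= C by rewrite /C !addr_ge0 ?mulr_ge0.
have e0 : 0 < - F p q / (C + 1) by rewrite divr_gt0 ?oppr_gt0 // ltr_wpDl.
have [x [y [xy]]] := H _ e0; set e := _ / _ => xp yq Fxy.
have [x1 y1] := unit x y xy.
have xp2 : `|x + p| <= 2 by rewrite (le_trans (ler_normD _ _)) //; lra.
have yq2 : `|y + q| <= 2 by rewrite (le_trans (ler_normD _ _)) //; lra.
have eE : e * (C + 1) = - F p q by rewrite divfK // gt_eqF // ltr_wpDl.
have b1 := bound k1 _ 1 _ 1 xp; rewrite normr1 lexx in b1.
have b2 := bound k2 _ 1 _ 1 yq; rewrite normr1 lexx in b2.
have := bound k3 _ _ _ _ xp xp2; have := bound k5 _ _ _ _ yq yq2.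
have := bound k4 _ _ _ _ xp y1; have := bound k4 _ _ _ _ yq p1.
have := b1 isT; have := b2 isT; have e0' : 0 < e := e0.
rewrite /C /F in eE Fxy *; lra.
Qed.

(** Images of the unit vectors and of their sum give orthonormality, since lengths are preserved.
    The entry [d] needs separate care, because [preserver_arrow] says nothing about a matrix with
    [u = v = 0]. *)
Lemma preserver_arrow_isometry (R : realType) (phi : {linear 'M[R]_3 -> 'M[R]_3}) :
  preserves_lorentz_spectrum phi ->
  exists p1 p2 r1 r2, [/\ p1 ^+ 2 + p2 ^+ 2 = 1, r1 ^+ 2 + r2 ^+ 2 = 1,
    p1 * r1 + p2 * r2 = 0 &
    forall u v d, phi (arrow_mx 0 u v d) = arrow_mx 0 (u * p1 + v * r1) (u * p2 + v * r2) d].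
Proof.
move=> hphi.
have [|p1 [p2 [Ep]]] := @preserver_arrow R phi 1 0 0 hphi; first by lra.
have [|r1 [r2 [Er]]] := @preserver_arrow R phi 0 1 0 hphi; first by lra.
have [|s1 [s2 [Es]]] := @preserver_arrow R phi 1 1 0 hphi; first by lra.
(* The length 2 keeps [d = 1] and [d = - 1] within the range of [preserver_arrow]. *)
have [|f1 [f2 [Ef]]] := @preserver_arrow R phi 2 0 1 hphi; first by lra.
have [|g1 [g2 [Eg]]] := @preserver_arrow R phi 2 0 (- 1) hphi; first by lra.
move=> gN fN sN rN pN.
have : phi (arrow_mx 0 1 0 0 + arrow_mx 0 0 1 0) = arrow_mx 0 s1 s2 0.
  by rewrite arrow_mxD !(addr0, add0r).
rewrite linearD Ep Er arrow_mxD => E.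
have [_ s1E s2E _] := arrow_mx_inj E => {E}.
have : phi (4 *: arrow_mx 0 1 0 0) = arrow_mx 0 (f1 + g1) (f2 + g2) 0.
  have -> : 4 *: arrow_mx 0 1 0 0 = arrow_mx 0 2 0 1 + arrow_mx 0 2 0 (- 1) :> 'M[R]_3.
    by rewrite arrow_mxZ arrow_mxD; congr arrow_mx; ring.
  by rewrite linearD Ef Eg arrow_mxD addr0 subrr.
rewrite linearZ Ep /= arrow_mxZ => E.
have [_ f1E f2E _] := arrow_mx_inj E => {E}.
(* The vectors [f] and [g] have length 2 and sum to [4 p] with [p] a unit vector; strict convexity
   of the disc forces both to equal [2 p]. *)
have f12 : (f1 - 2 * p1) ^+ 2 + (f2 - 2 * p2) ^+ 2 = 0.
  have : (4 * p1 - f1) ^+ 2 + (4 * p2 - f2) ^+ 2 = 4.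
    by rewrite f1E f2E; lra.
  lra.
have {f12} [f1p f2p] : f1 = 2 * p1 /\ f2 = 2 * p2.
  move/eqP: f12; rewrite paddr_eq0 ?sqr_ge0 // !sqrf_eq0 !subr_eq0.
  by case/andP => /eqP -> /eqP ->.
exists p1, p2, r1, r2; split; [lra | lra | by rewrite -s1E -s2E in sN; lra | ].
move=> u v d.
have -> : arrow_mx 0 u v d = d *: arrow_mx 0 2 0 1 + (u - 2 * d) *: arrow_mx 0 1 0 0
    + v *: arrow_mx 0 0 1 0.
  by rewrite !arrow_mxZ !arrow_mxD; congr arrow_mx; ring.
set c := u - 2 * d; rewrite 2!linearD !linearZ /= Ep Er Ef !arrow_mxZ !arrow_mxD f1p f2p.
by congr arrow_mx; rewrite ?/c; ring.
Qed.

(* Adding [arrow_mx 0 (M * a) (M * b) (- M + n - rho)] makes [n] an eigenvalue with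
   eigenvector [(a, b, 1)], whose image spectrum pins the eigenvector of [n] to within
   [O(1 / sqrt M)] of [(p, q, 1)]. *)
Lemma preserver_transfer_le (R : realType) (phi : {linear 'M[R]_3 -> 'M[R]_3})
    (A : 'M[R]_3) (a b p q n rho : R) (B := phi A) :
  preserves_lorentz_spectrum phi ->
  a ^+ 2 + b ^+ 2 = 1 -> p ^+ 2 + q ^+ 2 = 1 ->
  (forall M d, phi (arrow_mx 0 (M * a) (M * b) d) = arrow_mx 0 (M * p) (M * q) d) ->
  A *m cv3 a b 1 = cv3 (n * a) (n * b) rho ->
  [/\ p * (B 1 0 * p + B 1 1 * q + B 1 2) = q * (B 0 0 * p + B 0 1 * q + B 0 2),
      p * (B 0 0 * p + B 0 1 * q + B 0 2) + q * (B 1 0 * p + B 1 1 * q + B 1 2) <= n &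
      rho <= B 2 0 * p + B 2 1 * q + B 2 2].
Proof.
move=> hphi ab pq phiM AE.
have key e : 0 < e -> exists x y t, [/\ x ^+ 2 + y ^+ 2 <= 1, `|x - p| <= e, `|y - q| <= e, 0 <= t &
   [/\ B 0 0 * x + B 0 1 * y + B 0 2 = (n - t) * x,
       B 1 0 * x + B 1 1 * y + B 1 2 = (n - t) * y &
       rho <= B 2 0 * x + B 2 1 * y + B 2 2]].
  move=> e0.
  set C := `|B 2 0| + `|B 2 1| + `|B 2 2| + `|rho|.
  have C0 : 0 <= C by rewrite /C !addr_ge0.
  (* The last row will give [M (1 - (p x + q y)) <= C]; this [M] turns that into
     [2 (1 - (p x + q y)) <= e^2], which bounds the squared distance from [(x, y)] to [(p, q)]. *)
  set M := (2 * C + 1) / e ^+ 2.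
  have e20 : 0 < e ^+ 2 by rewrite exprn_gt0.
  have M0 : 0 < M by rewrite divr_gt0 //; lra.
  have ME : M * e ^+ 2 = 2 * C + 1 by rewrite divfK // gt_eqF.
  set T := arrow_mx 0 (M * a) (M * b) (- M + n - rho).
  have : lorentz_spectrum (phi (A + T)) n.
    rewrite hphi; apply/lorentz_spectrumP; exists a, b, 0; split => //.
    - by rewrite ab.
    - by rewrite mul0r.
    rewrite mulmxDl AE mulmx_cv3 !mx3E subr0 addr0.
    have Mab : M * a ^+ 2 + M * b ^+ 2 = M by rewrite -mulrDr ab mulr1.
    by rewrite cv3D; congr cv3; lra.
  rewrite linearD phiM -/B => /lorentz_spectrumP [x [y [t [t0 xy _]]]].
  rewrite mulmxDl !mulmx_cv3 !mx3E cv3D => E.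
  have [E0 E1 E2] := cv3_inj E => {E}.
  have x1 : `|x| <= 1 by rewrite -(@ler_pXn2r _ 2) ?nnegrE // expr1n real_normK ?num_real //; have := sqr_ge0 y; lra.
  have y1 : `|y| <= 1 by rewrite -(@ler_pXn2r _ 2) ?nnegrE // expr1n real_normK ?num_real //; have := sqr_ge0 x; lra.
  have B0 : B 2 0 * x <= `|B 2 0|.
    by rewrite (le_trans (ler_norm _)) // normrM ler_piMr.
  have B1 : B 2 1 * y <= `|B 2 1|.
    by rewrite (le_trans (ler_norm _)) // normrM ler_piMr.
  have B2 := ler_norm (B 2 2); have rh := ler_norm (- rho); rewrite normrN in rh.
  have cs0 : 0 <= 1 - (p * x + q * y).
    have := sqr_ge0 (x - p); have := sqr_ge0 (y - q); lra.
  have Mcs0 : 0 <= M * (1 - (p * x + q * y)) by rewrite mulr_ge0 // ltW.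
  have McsC : M * (1 - (p * x + q * y)) <= C by rewrite /C; lra.
  have cse : 2 * (1 - (p * x + q * y)) <= e ^+ 2.
    by rewrite -(ler_pM2l M0) ME; lra.
  have dist : (x - p) ^+ 2 + (y - q) ^+ 2 <= e ^+ 2 by lra.
  exists x, y, t; split => //.
  - rewrite -(@ler_pXn2r _ 2) ?nnegrE ?(ltW e0) // real_normK ?num_real //.
    by have := sqr_ge0 (y - q); lra.
  - rewrite -(@ler_pXn2r _ 2) ?nnegrE ?(ltW e0) // real_normK ?num_real //.
    by have := sqr_ge0 (x - p); lra.
  - by split; lra.
have pq1 : p ^+ 2 + q ^+ 2 <= 1 by rewrite pq.
split.
(* Eliminating [n - t] from the first two rows leaves a quadratic equation in [(x, y)]; it passes to
   the limit as two inequalities. *)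
- apply/eqP; rewrite eq_le; apply/andP; split.
    have := @quad_closed R 0 (- B 1 2) (B 0 2) (- B 1 0) (B 0 0 - B 1 1) (B 0 1) p q pq1.
    have H e : 0 < e -> exists x y, [/\ x ^+ 2 + y ^+ 2 <= 1, `|x - p| <= e, `|y - q| <= e &
      0 <= 0 + - B 1 2 * x + B 0 2 * y + - B 1 0 * x ^+ 2 + (B 0 0 - B 1 1) * (x * y) + B 0 1 * y ^+ 2].
      move=> /key [x [y [t [xy xp yq t0 [E0 E1 E2]]]]]; exists x, y; split => //.
      have : y * (B 0 0 * x + B 0 1 * y + B 0 2) = x * (B 1 0 * x + B 1 1 * y + B 1 2).
        by rewrite E0 E1; ring.
      lra.
    by move=> /(_ H); lra.
  have := @quad_closed R 0 (B 1 2) (- B 0 2) (B 1 0) (B 1 1 - B 0 0) (- B 0 1) p q pq1.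
  have H e : 0 < e -> exists x y, [/\ x ^+ 2 + y ^+ 2 <= 1, `|x - p| <= e, `|y - q| <= e &
    0 <= 0 + B 1 2 * x + - B 0 2 * y + B 1 0 * x ^+ 2 + (B 1 1 - B 0 0) * (x * y) + - B 0 1 * y ^+ 2].
    move=> /key [x [y [t [xy xp yq t0 [E0 E1 E2]]]]]; exists x, y; split => //.
    have : y * (B 0 0 * x + B 0 1 * y + B 0 2) = x * (B 1 0 * x + B 1 1 * y + B 1 2).
      by rewrite E0 E1; ring.
    lra.
  by move=> /(_ H); lra.
(* The bound [n] is multiplied by [x^2 + y^2], so that the difference is exactly [t (x^2 + y^2)],
   which is nonnegative. *)
- have := @quad_closed R 0 (- B 0 2) (- B 1 2) (n - B 0 0) (- B 0 1 - B 1 0) (n - B 1 1) p q pq1.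
  have H e : 0 < e -> exists x y, [/\ x ^+ 2 + y ^+ 2 <= 1, `|x - p| <= e, `|y - q| <= e &
    0 <= 0 + - B 0 2 * x + - B 1 2 * y + (n - B 0 0) * x ^+ 2 + (- B 0 1 - B 1 0) * (x * y) + (n - B 1 1) * y ^+ 2].
    move=> /key [x [y [t [xy xp yq t0 [E0 E1 E2]]]]]; exists x, y; split => //.
    have : x * (B 0 0 * x + B 0 1 * y + B 0 2) + y * (B 1 0 * x + B 1 1 * y + B 1 2)
        = n * (x ^+ 2 + y ^+ 2) - t * (x ^+ 2 + y ^+ 2).
      by rewrite E0 E1; ring.
    have : 0 <= t * (x ^+ 2 + y ^+ 2) by rewrite mulr_ge0 // addr_ge0 ?sqr_ge0.
    lra.
  have npq : n * p ^+ 2 + n * q ^+ 2 = n by rewrite -mulrDr pq mulr1.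
  by move=> /(_ H); lra.
have := @quad_closed R (B 2 2 - rho) (B 2 0) (B 2 1) 0 0 0 p q pq1.
have H e : 0 < e -> exists x y, [/\ x ^+ 2 + y ^+ 2 <= 1, `|x - p| <= e, `|y - q| <= e &
  0 <= B 2 2 - rho + B 2 0 * x + B 2 1 * y + 0 * x ^+ 2 + 0 * (x * y) + 0 * y ^+ 2].
  move=> /key [x [y [t [xy xp yq t0 [E0 E1 E2]]]]]; exists x, y; split => //.
  lra.
by move=> /(_ H); lra.
Qed.

(** The inequalities for [A] and for [- A] are opposite, so the radial and last components are
    determined; together with the vanishing tangential component they determine the image vector. *)
Lemma preserver_transfer (R : realType) (phi : {linear 'M[R]_3 -> 'M[R]_3})
    (A : 'M[R]_3) (a b p q n rho : R) :
  preserves_lorentz_spectrum phi ->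
  a ^+ 2 + b ^+ 2 = 1 -> p ^+ 2 + q ^+ 2 = 1 ->
  (forall M d, phi (arrow_mx 0 (M * a) (M * b) d) = arrow_mx 0 (M * p) (M * q) d) ->
  A *m cv3 a b 1 = cv3 (n * a) (n * b) rho ->
  phi A *m cv3 p q 1 = cv3 (n * p) (n * q) rho.
Proof.
move=> hphi ab pq phiM AE.
have [E1 nle rle] := preserver_transfer_le hphi ab pq phiM AE.
have AE' : - A *m cv3 a b 1 = cv3 (- n * a) (- n * b) (- rho).
  by rewrite mulNmx AE; apply: cv3P; rewrite mxE !cv3E ?mulNr.
have [_ nge rge] := preserver_transfer_le hphi ab pq phiM AE'.
rewrite linearN in nge rge; rewrite mulmx_cv3 !mulr1.
move: E1 nle rle nge rge; set B := phi A; rewrite ![(- B) _ _]mxE.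
set V0 := B 0 0 * p + _ + _; set V1 := B 1 0 * p + _ + _; move=> E1 nle rle nge rge.
have nE : p * V0 + q * V1 = n by rewrite /V0 /V1 in nle *; apply/eqP; rewrite eq_le; apply/andP; split; lra.
congr cv3.
- rewrite -nE -[LHS]mul1r -pq.
  have : q * (p * V1) = q * (q * V0) by rewrite E1.
  lra.
- rewrite -nE -[LHS]mul1r -pq.
  have : p * (p * V1) = p * (q * V0) by rewrite E1.
  lra.
by lra.
Qed.

(** * Invariance of both spectra under orthogonal automorphisms of the cone *)

Lemma mulmx_continuous (R : numFieldType) (m n p : nat) (A : 'M[R]_(m, n)) :
  continuous (mulmx A : 'M[R]_(n, p) -> 'M[R]_(m, p)).
Proof.
move=> M s [P MP sP]; have FM : Filter (nbhs M) := nbhs_filter M.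
apply: (@filterS _ (nbhs M) _ (fun N => forall i j, P i j ((A *m N) i j))) => [N NP|].
  exact: sP.
apply: (@filter_forall _ _ (fun i N => forall j, P i j ((A *m N) i j)) _ (nbhs_filter M)) => i.
apply: (@filter_forall _ _ (fun j N => P i j ((A *m N) i j)) _ (nbhs_filter M)) => j.
have cM : (A *m N) i j @[N --> M] --> (A *m M) i j.
  under eq_fun do rewrite mxE.
  rewrite mxE; apply: cvg_big => [|k _]; first exact: add_continuous.
  exact: cvgM (cvg_cst _) (@coord_continuous R n p k j M).
exact: cM (MP i j).
Qed.

(** The relation [B P = P A] passes to [B - lam] and [A - lam], and orthogonality of [P] keeps the
    scalar product zero. *)
Lemma eigenpair_mulmx (R : realType) (A B P P' : 'M[R]_3) lam x :
  P' *m P = 1%:M -> P^T = P' -> B *m P = P *m A ->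
  (forall x, lorentz_cone x -> lorentz_cone (P *m x)) ->
  lorentz_eigenpair A lam x -> lorentz_eigenpair B lam (P *m x).
Proof.
move=> P'P trP BP Pcone [x0 xK AxK xA].
have BlP : (B - lam%:M) *m (P *m x) = P *m ((A - lam%:M) *m x).
  by rewrite !mulmxA mulmxBl BP mulmxBr scalar_mxC.
split.
- apply: contraNneq x0 => Px0.
  by rewrite -[x]mul1mx -P'P -mulmxA Px0 mulmx0.
- exact: Pcone.
- by rewrite BlP; exact: Pcone.
by rewrite -mulmxA BlP trmx_mul trP mulmxA -[x^T *m P' *m P]mulmxA P'P mulmx1 mulmxA.
Qed.

Lemma interior_cone_mulmx (R : realType) (P P' : 'M[R]_3) x :
  P *m P' = 1%:M -> P' *m P = 1%:M ->
  (forall x, lorentz_cone x -> lorentz_cone (P *m x)) ->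
  (forall x, lorentz_cone x -> lorentz_cone (P' *m x)) ->
  interior (@lorentz_cone R) (P *m x) <-> interior (@lorentz_cone R) x.
Proof.
move=> PP' P'P Pcone P'cone; split => h.
  have : nbhs x (mulmx P @^-1` @lorentz_cone R) by exact: mulmx_continuous.
  apply: filterS => y /= /P'cone.
  by rewrite mulmxA P'P mul1mx.
have : nbhs (P *m x) (mulmx P' @^-1` @lorentz_cone R).
  by apply: mulmx_continuous; rewrite mulmxA P'P mul1mx.
apply: filterS => y /= /Pcone.
by rewrite mulmxA PP' mul1mx.
Qed.

Lemma spectrum_int_bd_sub (R : realType) (A B P P' : 'M[R]_3) :
  P *m P' = 1%:M -> P' *m P = 1%:M -> P^T = P' -> B *m P = P *m A ->
  (forall x, lorentz_cone x -> lorentz_cone (P *m x)) ->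
  (forall x, lorentz_cone x -> lorentz_cone (P' *m x)) ->
  lorentz_spectrum_int A `<=` lorentz_spectrum_int B /\
  lorentz_spectrum_bd A `<=` lorentz_spectrum_bd B.
Proof.
move=> PP' P'P trP BP Pcone P'cone.
split=> lam [x [xE xK]]; have xE' := eigenpair_mulmx P'P trP BP Pcone xE;
  exists (P *m x).
  by split=> //; apply/(interior_cone_mulmx x PP' P'P Pcone P'cone).
split=> //; case: xE' => _ PxK _ _.
(* The vector [P x] is in the cone, hence in its closure; only not being interior has to be carried
   over. *)
case: xK => _ xK; split; first exact: subset_closure.
by move=> /(interior_cone_mulmx x PP' P'P Pcone P'cone).
Qed.

(** The planar block is listed by columns, the images of the two unit vectors. Reflections are
    included, and exchanging [p2] and [r1] transposes the matrix. *)
Definition rot_mx (R : pzRingType) (p1 p2 r1 r2 : R) : 'M[R]_3 :=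
  mx3 p1 r1 0 p2 r2 0 0 0 1.

Lemma lorentz_cone_rot (R : realType) (p1 p2 r1 r2 : R) (x : 'cV[R]_3) :
  p1 ^+ 2 + p2 ^+ 2 = 1 -> r1 ^+ 2 + r2 ^+ 2 = 1 -> p1 * r1 + p2 * r2 = 0 ->
  lorentz_cone x -> lorentz_cone (rot_mx p1 p2 r1 r2 *m x).
Proof.
move=> pN rN pr /lorentz_coneP [x2 xK]; apply/lorentz_coneP.
rewrite !mulmx3E !mx3E !mul0r !addr0 !add0r mul1r; split=> //.
have -> : (p1 * x 0 0 + r1 * x 1 0) ^+ 2 + (p2 * x 0 0 + r2 * x 1 0) ^+ 2 =
    (p1 ^+ 2 + p2 ^+ 2) * x 0 0 ^+ 2 + (r1 ^+ 2 + r2 ^+ 2) * x 1 0 ^+ 2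
    + 2 * (p1 * r1 + p2 * r2) * (x 0 0 * x 1 0) by ring.
by rewrite pN rN pr; lra.
Qed.

Lemma trmx_rot (R : pzRingType) (p1 p2 r1 r2 : R) :
  (rot_mx p1 p2 r1 r2)^T = rot_mx p1 r1 p2 r2.
Proof. by apply: mx3P; rewrite mxE !mx3E. Qed.

Lemma rot_mx_orthogonal (R : realType) (p1 p2 r1 r2 : R) :
  p1 ^+ 2 + p2 ^+ 2 = 1 -> r1 ^+ 2 + r2 ^+ 2 = 1 -> p1 * r1 + p2 * r2 = 0 ->
  rot_mx p1 r1 p2 r2 *m rot_mx p1 p2 r1 r2 = 1%:M.
Proof.
by move=> *; apply: mx3P; rewrite mulmx3E !mx3E mxE /=; lra.
Qed.

(** * The intertwining relation and the conclusion *)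

Lemma preserver_intertwine (R : realType) (phi : {linear 'M[R]_3 -> 'M[R]_3}) :
  preserves_lorentz_spectrum phi ->
  exists p1 p2 r1 r2, [/\ p1 ^+ 2 + p2 ^+ 2 = 1, r1 ^+ 2 + r2 ^+ 2 = 1,
    p1 * r1 + p2 * r2 = 0 &
    forall A, phi A *m rot_mx p1 p2 r1 r2 = rot_mx p1 p2 r1 r2 *m A].
Proof.
move=> hphi; have [p1 [p2 [r1 [r2 [pN rN pr phiE]]]]] := preserver_arrow_isometry hphi.
exists p1, p2, r1, r2; split => //; set P := rot_mx p1 p2 r1 r2.
(* The second hypothesis says that [A (a, b, 1)] has no tangential component at [(a, b)]; [n] and
   [rho] below are its radial and last components. *)
have fixed (A : 'M[R]_3) (a b : R) : a ^+ 2 + b ^+ 2 = 1 ->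
    a * (A 1 0 * a + A 1 1 * b + A 1 2) = b * (A 0 0 * a + A 0 1 * b + A 0 2) ->
    (phi A *m P - P *m A) *m cv3 a b 1 = 0.
  move=> ab tang.
  pose n := a * (A 0 0 * a + A 0 1 * b + A 0 2) + b * (A 1 0 * a + A 1 1 * b + A 1 2).
  pose rho := A 2 0 * a + A 2 1 * b + A 2 2.
  have AE : A *m cv3 a b 1 = cv3 (n * a) (n * b) rho.
    rewrite mulmx_cv3 !mulr1; congr cv3; rewrite /n.
      rewrite -[LHS]mul1r -ab; move: tang => /(congr1 ( *%R b)); lra.
    rewrite -[LHS]mul1r -ab; move: tang => /(congr1 ( *%R a)); lra.
  have PE (c : R) : P *m cv3 (c * a) (c * b) rho =
      cv3 (c * (a * p1 + b * r1)) (c * (a * p2 + b * r2)) rho.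
    by rewrite mulmx_cv3 !mx3E; congr cv3; ring.
  rewrite mulmxBl -!mulmxA AE PE.
  have -> : P *m cv3 a b 1 = cv3 (a * p1 + b * r1) (a * p2 + b * r2) 1.
    by rewrite mulmx_cv3 !mx3E; congr cv3; ring.
  rewrite (preserver_transfer hphi ab _ _ AE) ?subrr //.
    have -> : (a * p1 + b * r1) ^+ 2 + (a * p2 + b * r2) ^+ 2 =
      a ^+ 2 * (p1 ^+ 2 + p2 ^+ 2) + b ^+ 2 * (r1 ^+ 2 + r2 ^+ 2)
      + 2 * (a * b) * (p1 * r1 + p2 * r2) by ring.
    by rewrite pN rN pr mulr0 addr0 !mulr1.
  by move=> M d; rewrite phiE; congr arrow_mx; ring.
(* Any three of the four chosen boundary vectors form a basis; [s] selects the third one. *)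
have kill (D : 'M[R]_3) (s : R) : s ^+ 2 = 1 -> D *m cv3 1 0 1 = 0 -> D *m cv3 (- 1) 0 1 = 0 ->
    D *m cv3 0 s 1 = 0 -> D = 0.
  move=> s2 /colP D1 /colP D2 /colP D3; apply/matrixP => i j.
  have := (D1 i, D2 i, D3 i); rewrite !mulmx3E !cv3E !mxE => -[[E1 E2] E3].
  have Di2 : D i 2 = 0 by lra.
  have Di0 : D i 0 = 0 by lra.
  have Di1 : D i 1 = 0.
    by have := congr1 ( *%R s) E3; rewrite Di0 Di2 -[RHS]/(s * 0) => ?; rewrite -[LHS]mulr1 -s2; lra.
  by elim/ord3_ind: j.
have kill' (D : 'M[R]_3) (s : R) : s ^+ 2 = 1 -> D *m cv3 0 1 1 = 0 -> D *m cv3 0 (- 1) 1 = 0 ->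
    D *m cv3 s 0 1 = 0 -> D = 0.
  move=> s2 /colP D1 /colP D2 /colP D3; apply/matrixP => i j.
  have := (D1 i, D2 i, D3 i); rewrite !mulmx3E !cv3E !mxE => -[[E1 E2] E3].
  have Di2 : D i 2 = 0 by lra.
  have Di1 : D i 1 = 0 by lra.
  have Di0 : D i 0 = 0.
    by have := congr1 ( *%R s) E3; rewrite Di1 Di2 -[RHS]/(s * 0) => ?; rewrite -[LHS]mulr1 -s2; lra.
  by elim/ord3_ind: j.
(* The entries [- s x] and [x] cancel in the first coordinate at [(0, s, 1)], and the zeros of the
   middle row remove the tangential component at [(1, 0, 1)] and [(- 1, 0, 1)]. *)
have row0 (s a x e g h k : R) : s ^+ 2 = 1 ->
    phi (mx3 a (- s * x) x 0 e 0 g h k) *m P = P *m mx3 a (- s * x) x 0 e 0 g h k.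
  move=> s2; apply/eqP; rewrite -subr_eq0; apply/eqP.
  have sx : s * (s * (s * x)) = s * x by rewrite [s * (s * _)]mulrA -expr2 s2 mul1r.
  by apply: (kill _ s) => //; apply: fixed; rewrite ?mx3E; lra.
have row1 (s x : R) : s ^+ 2 = 1 ->
    phi (mx3 0 0 0 (- s * x) 0 x 0 0 0) *m P = P *m mx3 0 0 0 (- s * x) 0 x 0 0 0.
  move=> s2; apply/eqP; rewrite -subr_eq0; apply/eqP.
  have sx : s * (s * (s * x)) = s * x by rewrite [s * (s * _)]mulrA -expr2 s2 mul1r.
  by apply: (kill' _ s) => //; apply: fixed; rewrite ?mx3E; lra.
move=> A.
(* A pair [(x, y)] is [(h, h) + (- k, k)], the two shapes allowed for [s = - 1] and [s = 1]. *)
pose h (x y : R) := (x + y) / 2; pose k (x y : R) := (y - x) / 2.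
have -> : A = mx3 (A 0 0) (- - 1 * h (A 0 1) (A 0 2)) (h (A 0 1) (A 0 2)) 0 (A 1 1) 0 (A 2 0) (A 2 1) (A 2 2)
  + mx3 0 (- 1 * k (A 0 1) (A 0 2)) (k (A 0 1) (A 0 2)) 0 0 0 0 0 0
  + mx3 0 0 0 (- - 1 * h (A 1 0) (A 1 2)) 0 (h (A 1 0) (A 1 2)) 0 0 0
  + mx3 0 0 0 (- 1 * k (A 1 0) (A 1 2)) 0 (k (A 1 0) (A 1 2)) 0 0 0.
  by rewrite !mx3D; apply: mx3P; rewrite mx3E /h /k; lra.
rewrite !linearD /= !mulmxDl.
by rewrite !row0 ?row1 ?sqrrN ?expr1n.
Qed.

Theorem theorem3p2 (R : realType) (phi : {linear 'M[R]_3 -> 'M[R]_3})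
    (hphi : preserves_lorentz_spectrum phi) (A : 'M[R]_3) :
  lorentz_spectrum_int A = lorentz_spectrum_int (phi A) /\
  lorentz_spectrum_bd A = lorentz_spectrum_bd (phi A).
Proof.
have [p1 [p2 [r1 [r2 [pN rN pr BP]]]]] := preserver_intertwine hphi.
have P'P := rot_mx_orthogonal pN rN pr; have PP' := mulmx1C P'P.
(* A left inverse is also a right inverse, so the rows of the planar block are orthonormal too;
   hence the inverse preserves the cone and gives the reverse inclusions. *)
have := congr1 (fun M : 'M[R]_3 => (M 0 0, M 1 1, M 0 1)) PP'.
rewrite !mulmx3E !mx3E !mxE /= => -[pN' rN' pr'].
have Pcone (x : 'cV[R]_3) := @lorentz_cone_rot _ _ _ _ _ x pN rN pr.
have P'cone x : lorentz_cone x -> lorentz_cone (rot_mx p1 r1 p2 r2 *m x).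
  by apply: lorentz_cone_rot; lra.
have BP' : A *m rot_mx p1 r1 p2 r2 = rot_mx p1 r1 p2 r2 *m phi A.
  by rewrite -[LHS]mul1mx -P'P -mulmxA [_ *m (A *m _)]mulmxA -BP -mulmxA PP' mulmx1.
have [iAB bAB] := spectrum_int_bd_sub PP' P'P (trmx_rot _ _ _ _) (BP A) Pcone P'cone.
have [iBA bBA] := spectrum_int_bd_sub P'P PP' (trmx_rot _ _ _ _) BP' P'cone Pcone.
by split; apply/seteqP.
Qed.
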